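(* Let $X$ and $Y$ be topological spaces, let $S\subseteq X$ be a dense subset of $X$, and let $f:S\rightarrow Y$ be a continuous mapping (with $S$ carrying the subspace topology). For $x\in X$ put $K(x)=\{M\subseteq S \mid x\in [M]\}$. Then: (Necessity) if there exists a $\theta$-continuous mapping $F:X\rightarrow Y$ whose restriction to $S$ coincides with $f$, then $\bigcap_{M\in K(x)}[f(M)]_\theta\neq\emptyset$ for every $x\in X$; (Sufficiency) if $\bigcap_{M\in K(x)}[f(M)]\neq\emptyset$ for every $x\in X$, then there exists a $\theta$-continuous mapping $F:X\rightarrow Y$ whose restriction to $S$ coincides with $f$.
   Context: Square brackets $[\,\cdot\,]$ denote closure: $[M]$ for $M\subseteq X$ is the closure in $X$, and $[B]$ for $B\subseteq Y$ is the closure in $Y$. A neighbourhood of a point is an open set containing that point. No separation or compactness axioms are assumed on $X$ or $Y$. For $B\subseteq Y$, the $\theta$-closure $[B]_\theta$ is the set of all points $y\in Y$ such that $[U]\cap B\neq\emptyset$ for every neighbourhood $U$ of $y$. A mapping $F:X\rightarrow Y$ is $\theta$-continuous (also called weakly continuous) if for every point $x\in X$ and every neighbourhood $U$ of $F(x)$ in $Y$ there is a neighbourhood $Ox$ of $x$ in $X$ such that $F(Ox)\subseteq [U]$. *)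

(* Defs.v *)
From HB Require Import structures.
From mathcomp Require Import all_boot all_order all_algebra.
From mathcomp Require Import all_classical all_reals topology.

Set Implicit Arguments.
Unset Strict Implicit.
Unset Printing Implicit Defensive.

Local Open Scope classical_set_scope.

Definition theta_closure (Y : topologicalType) (B : set Y) : set Y :=
  [set y | forall U : set Y, open_nbhs y U -> closure U `&` B !=set0].

Definition theta_continuous (X Y : topologicalType) (F : X -> Y) : Prop :=
  forall (x : X) (U : set Y), open_nbhs (F x) U ->
    exists2 O : set X, open_nbhs x O & F @` O `<=` closure U.

Definition clusters_in (X : topologicalType) (S : set X) (x : X) :
    set (set X) :=
  [set M | M `<=` S /\ closure M x].

(* The image under [f : S -> Y] of a set [M] of points of the ambient space;
   the points of [M] lying outside [S] are ignored. *)
Definition sub_image (X Y : Type) (S : set X) (f : S -> Y) (M : set X) :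
    set Y :=
  f @` (set_val @^-1` M).

(* Main.v *)
(** For the sufficiency part, pick [F x] in the intersection of the sets
    [closure (f M)], taking [F = f] on [S]; continuity of [f] makes this choice
    legitimate at points of [S].  Given a neighbourhood [U] of [F x], the point
    [x] is not in the closure of [S \ f^-1(U)], so some open [O] around [x] has
    [f (O `&` S) `<=` U].  By density every [z] in [O] is adherent to
    [O `&` S], hence [F z] is adherent to [f (O `&` S)], so [F z] lies in
    [closure U]. *)

Require Import Defs.
From mathcomp Require Import all_boot all_order all_algebra.
From mathcomp Require Import all_classical all_reals topology.

Local Open Scope classical_set_scope.

(** For necessity, [F x] itself is the common point: a neighbourhood of [x] mapped into [closure U]
    meets [M], and the image of a shared point is the witness. *)
Lemma theta_continuous_theta_closure {X Y : topologicalType} {F : X -> Y}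
    {M : set X} {x : X} :
  theta_continuous F -> closure M x -> theta_closure (F @` M) (F x).
Proof.
move=> thF Mx U /thF[O /open_nbhs_nbhs Ox FOU].
have [m [Mm Om]] := Mx O Ox.
by exists (F m); split; [apply: FOU|]; exists m.
Qed.

Lemma sub_image_sigL {X Y : Type} {S : set X} (F : X -> Y) {M : set X} :
  M `<=` S -> sub_image (sigL S F) M = F @` M.
Proof.
move=> MS; apply/seteqP; split => [_ [s Ms <-]|_ [m Mm <-]].
  by exists (set_val s).
by exists (SigSub (mem_set (MS m Mm))).
Qed.

Lemma closure_sub_image {X Y : topologicalType} {S : set X} {f : S -> Y}
    {M : set X} {s : S} :
  continuous f -> clusters_in S (set_val s) M -> closure (sub_image f M) (f s).
Proof.
move=> contf [MS Ms] B /contf[_ [[O oO <-] Os] OfB].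
have [m [Mm Om]] := Ms O (open_nbhs_nbhs (conj oO Os)).
pose t : S := SigSub (mem_set (MS m Mm)).
by exists (f t); split; [exists t|apply: OfB].
Qed.

Lemma theta_continuous_extension {X Y : topologicalType} {S : set X} {F : X -> Y} :
  dense S ->
  (forall x M, clusters_in S x M -> closure (F @` M) (F x)) ->
  theta_continuous F.
Proof.
move=> denseS adhF x U FxU.
have [O Ox OU] : exists2 O, open_nbhs x O & O `&` S `<=` F @^-1` U.
  (* Otherwise [F x] would be adherent to the image of this set, which misses the neighbourhood [U]
     of [F x]. *)
  have nMx : ~ closure (S `\` F @^-1` U) x.
    move=> Mx; have /adhF adh : clusters_in S x (S `\` F @^-1` U).
      by split => // z [].
    by have [_ [[z [_ nUz] <-] /nUz]] := adh U (open_nbhs_nbhs FxU).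
  apply: contrapT => nO; apply: nMx => B; rewrite nbhsE => -[O Ox OB].
  apply: contrapT => nB; apply: nO; exists O => // z [Oz Sz].
  by apply: contrapT => nUz; apply: nB; exists z; split => //; apply: OB.
exists O => // _ [z Oz <-].
have [oO _] := Ox.
have /adhF : clusters_in S z (O `&` S).
  split=> [t []//|B]; rewrite nbhsE => -[V [oV Vz] VB].
  have [t [[Ot Vt] St]] : (O `&` V) `&` S !=set0.
    by apply: denseS; [exists z|apply: openI].
  by exists t; split; [|apply: VB].
by apply: closureS => _ [t /OU Ut <-].
Qed.

Theorem theorem1 (X Y : topologicalType) (S : set X) (f : S -> Y)
    (denseS : dense S) (contf : continuous f) :
  ((exists F : X -> Y, theta_continuous F /\ sigL S F = f) ->
   forall x : X,
     \bigcap_(M in clusters_in S x) theta_closure (sub_image f M) !=set0)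
  /\
  ((forall x : X,
     \bigcap_(M in clusters_in S x) closure (sub_image f M) !=set0) ->
   exists F : X -> Y, theta_continuous F /\ sigL S F = f).
Proof.
split=> [[F [thF <-]] x|capf].
  exists (F x) => M [MS Mx]; rewrite sub_image_sigL //.
  exact: theta_continuous_theta_closure.
(* The second clause pins [F] to [f] on [S] and is vacuous off [S], so one choice serves both
   cases. *)
have /choice[F FP] : forall x, exists y,
    (\bigcap_(M in clusters_in S x) closure (sub_image f M)) y /\
    forall s : S, set_val s = x -> f s = y.
  move=> x; have [Sx|nSx] := pselect (S x).
    pose s : S := SigSub (mem_set Sx).
    exists (f s); split=> [M SM|t tx]; first exact: (@closure_sub_image _ _ _ _ _ s).
    by congr f; apply: val_inj.
  have [y fy] := capf x; exists y; split=> // s sx.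
  by case: nSx; rewrite -sx; apply: set_valP.
have FE : sigL S F = f.
  by apply/funext => s /=; rewrite -((FP (set_val s)).2 s).
exists F; split=> //; apply: (theta_continuous_extension denseS) => x M SM.
(* As [F] extends [f], both have the same image of [M], so the choice of [F x] becomes a condition
   on [F] alone. *)
by have := (FP x).1 M SM; rewrite -FE sub_image_sigL //; case: SM.
Qed.
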